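(* Let $T$ be a simply connected immersed triangulation in the plane with edge set $E$, and let $\vartheta\in[0,\pi/2]$. The function $\mathcal{F}_\vartheta$ which is a local integral of the 1-form $\Xi_\vartheta$ (that is, $d\mathcal{F}_\vartheta=\Xi_\vartheta$) is locally concave, that is, the second derivative is a negative semidefinite quadratic form. Its one-dimensional kernel is spanned by $(1,1,\dots,1)$.
   Context: Triangulation: $T$ is a (locally) embedded, i.e. immersed, non-degenerate triangulation in the plane $\mathbb{C}$ with vertices $v_i\in\mathbb{C}$, edges $e=[v_i,v_j]\in E$, interior edges $E_{int}$ (those contained in two triangles), and triangles $\Delta[v_i,v_j,v_k]$ with vertices listed counterclockwise. An interior vertex together with its incident triangles is a flower. Write $w_{ij}=v_j-v_i$, and let $\alpha_k^{\Delta[v_i,v_j,v_k]}\in(0,\pi)$ be the angle at $v_k$. Discrete immersion: a map $F:T\to\mathbb{C}$ which is continuous, affine-linear on every triangle and orientation preserving, such that for every flower all pairs of image triangles intersect only in their common vertex or edge. Write $z_i=F(v_i)$ and $z_{ij}=z_j-z_i$. Cross-ratios: $\mathrm{cr}(z_1,z_2,z_3,z_4)=\frac{(z_1-z_2)(z_3-z_4)}{(z_2-z_3)(z_4-z_1)}$. For an interior edge $[v_i,v_j]$ with adjacent triangles $\Delta[v_i,v_j,v_k]$ and $\Delta[v_i,v_l,v_j]$ put $Q([v_i,v_j])=\mathrm{cr}(v_i,v_l,v_j,v_k)$ and $q([v_i,v_j])=\mathrm{cr}(z_i,z_l,z_j,z_k)$. Discrete $\vartheta$-conformal map: a discrete immersion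 $F$ with $\mathrm{Re}[e^{-i\vartheta}\log Q(e)]=\mathrm{Re}[e^{-i\vartheta}\log q(e)]$ for every interior edge $e$, where the logarithms take values in $\mathbb{R}+i(0,2\pi)$. Variables: for a discrete immersion $F$, real numbers $\omega_{ij},\nu_{ij}$ on the edges are given by $z_{ij}=w_{ij}\exp(e^{i\vartheta}(i\omega_{ij}+\nu_{ij}))$, chosen such that in every triangle $\Delta[v_i,v_j,v_k]$ the angle of the image triangle at $z_k$ equals $\alpha_k^{\Delta[v_i,v_j,v_k]}+\cos\vartheta(\omega_{jk}-\omega_{ki})+\sin\vartheta(\nu_{jk}-\nu_{ki})$, and cyclically. The $\omega$'s are the free variables, collected in a vector $\omega\in\mathbb{R}^{|E|}$ with entries $\omega_e$. In each triangle $\Delta=\Delta[v_i,v_j,v_k]$ the $\nu$'s are regarded as dependent real functions $\nu^\Delta(\omega)$ determined, up to a common additive constant in $\Delta$, by the closing condition $$w_{ij}\exp(e^{i\vartheta}(i\omega_{ij}+\nu^\Delta_{ij}))+w_{jk}\exp(e^{i\vartheta}(i\omega_{jk}+\nu^\Delta_{jk}))+w_{ki}\exp(e^{i\vartheta}(i\omega_{ki}+\nu^\Delta_{ki}))=0.$$ The variables $\omega$ vary within a neighborhood of given values which give rise to a discrete $\vartheta$-conformal map, so that the $\nu^\Delta(\omega)$ are well defined (up to these constants) and smooth. The two values of $\nu$ on one edge coming from its two triangles will in general be different. The 1-form: $$\Xi_\vartheta(\omega)=\sum_{e=[v_i,v_j]\in E_{int}}\big(\nu_{il}^{\Delta_{ilj}}-\nu_{lj}^{\Delta_{ilj}}+\nu_{jk}^{\Delta_{ijk}}-\nu_{ki}^{\Delta_{ijk}}\big)\,d\omega_e,$$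 where the sum is over all interior edges $e=[v_i,v_j]$, contained in the two counterclockwise triangles $\Delta_{ilj}=\Delta[v_i,v_l,v_j]$ and $\Delta_{ijk}=\Delta[v_i,v_j,v_k]$.
   Formalization: The 1-form is completed: each boundary edge also contributes the term ν_jk − ν_ki of its only triangle. Summed over interior edges only, the form is zero for a single triangle (kernel R^3) and otherwise not closed on R^|E|, so the claim fails as stated. *)

(* Defs.v *)
From HB Require Import structures.
From mathcomp Require Import all_boot all_order all_algebra.
From mathcomp Require Import all_classical all_reals all_analysis.
From mathcomp Require Import complex.

Set Implicit Arguments.
Unset Strict Implicit.
Unset Printing Implicit Defensive.

Import Order.TTheory GRing.Theory Num.Theory numFieldNormedType.Exports.

Local Open Scope classical_set_scope.
Local Open Scope ring_scope.
Local Open Scope complex_scope.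

Local Notation Re := complex.Re.
Local Notation Im := complex.Im.

(* R[i] comes without exponential or logarithm. *)
Section ComplexFunctions.
Variable R : realType.
Implicit Types a b c z : R[i].

Definition cexp z : R[i] :=
  (expR (Re z) * cos (Im z)) +i* (expR (Re z) * sin (Im z)).

Definition cabs z : R := Num.sqrt (Re z ^+ 2 + Im z ^+ 2).

(* The argument in [0, 2 pi[; it lies in ]0, 2 pi[ off the nonnegative reals. *)
Definition carg z : R :=
  if 0 <= Im z then acos (Re z / cabs z) else 2 * pi - acos (Re z / cabs z).

(* The logarithm with values in R + i ]0, 2 pi[ (off the nonnegative reals). *)
Definition clog z : R[i] := ln (cabs z) +i* carg z.

Definition cr (z1 z2 z3 z4 : R[i]) : R[i] :=
  ((z1 - z2) * (z3 - z4)) / ((z2 - z3) * (z4 - z1)).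

(* The angle in [0, pi] at c between the segments [c, a] and [c, b]. *)
Definition angle a c b : R :=
  acos (Re ((a - c) / (b - c)) / cabs ((a - c) / (b - c))).

End ComplexFunctions.

(* A finite oriented triangulated surface, possibly with boundary, on the
   vertex set V: [tri i j k] says that i, j, k are the vertices of a triangle
   listed counterclockwise.  By [tri_coherent] every edge lies in at most two
   triangles, and these induce opposite directions on it; by [tri_link] the
   triangles around a vertex form a single closed or open fan.  The points of
   the plane at the vertices are a separate map V -> R[i], so that distinct
   vertices of an immersed triangulation may lie at the same point. *)
Record triangulation (V : finType) := Triangulation {
  tri : V -> V -> V -> bool;
  tri_cycle : forall i j k, tri i j k -> tri j k i;
  tri_neq : forall i j k, tri i j k -> i != j;
  tri_coherent : forall i j k l, tri i j k -> tri i j l -> k = l;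
  tri_cover : forall i, exists j k, tri i j k;
  tri_link : forall i j k,
    [exists l, tri i j l || tri i l j] ->
    [exists l, tri i k l || tri i l k] ->
    connect (fun a b => tri i a b || tri i b a) j k
}.

Section Combinatorics.
Variables (V : finType) (T : triangulation V).

Definition simplex (S : {set V}) : bool :=
  [exists a, exists b, exists c, tri T a b c && (S \subset [set a; b; c])%SET].

Definition edges : {set {set V}} :=
  [set [set p.1; p.2]%SET | p : V * V & [exists k, tri T p.1 p.2 k]]%SET.

Definition interior_pair (i j : V) : bool :=
  [exists k, tri T i j k] && [exists l, tri T j i l].

Definition interior_edges : {set {set V}} :=
  [set [set p.1; p.2]%SET | p : V * V & interior_pair p.1 p.2]%SET.

Definition interior_vertex (i : V) : Prop :=
  forall j, [set i; j]%SET \in edges -> [set i; j]%SET \in interior_edges.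

(* Homotopy of edge paths, written as sequences of vertices in which any two
   consecutive vertices are equal or adjacent; the classes of closed paths form
   the edge-path group, i.e. the fundamental group of the surface. *)
Inductive edge_homotopic : seq V -> seq V -> Prop :=
| eh_step p i j k q : simplex [set i; j; k]%SET ->
    edge_homotopic (p ++ [:: i, j, k & q]) (p ++ [:: i, k & q])
| eh_refl p : edge_homotopic p p
| eh_sym p q : edge_homotopic p q -> edge_homotopic q p
| eh_trans p q r :
    edge_homotopic p q -> edge_homotopic q r -> edge_homotopic p r.

Definition edge_step : rel V := fun i j => simplex [set i; j]%SET.

Definition simply_connected : Prop :=
  [/\ (0 < #|V|)%N,
      forall i j, connect edge_step i j
    & forall i p, path edge_step i (rcons p i) ->
        edge_homotopic (i :: rcons p i) [:: i; i]].

End Combinatorics.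

Section Geometry.
Variables (R : realType) (V : finType) (T : triangulation V).
Implicit Types v z : V -> R[i].

Definition hull z (S : {set V}) : set R[i] :=
  [set p | exists t : V -> R,
     [/\ forall a, 0 <= t a, \sum_(a in S) t a = 1
       & p = \sum_(a in S) (t a)%:C * z a]].

(* A continuous map which is affine-linear on every triangle is given by its
   values z at the vertices.  The triangulation being drawn in the plane by
   vertex positions v, the requirement that it be non-degenerate, immersed and
   with triangles listed counterclockwise is [discrete_immersion v]. *)
Definition discrete_immersion z : Prop :=
  (forall i j k, tri T i j k ->
     0 < Im ((z k - z i) / (z j - z i))) /\
  (forall i a b c d, interior_vertex T i ->
     tri T i a b -> tri T i c d -> a != c ->
     hull z [set i; a; b]%SET `&` hull z [set i; c; d]%SET `<=`
     hull z ([set i; a; b] :&: [set i; c; d])%SET).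

Definition theta_conformal (theta : R) v z : Prop :=
  discrete_immersion z /\
  forall i j k l, tri T i j k -> tri T i l j ->
    Re (cexp (0 -i* theta) * clog (cr (v i) (v l) (v j) (v k))) =
    Re (cexp (0 -i* theta) * clog (cr (z i) (z l) (z j) (z k))).

(* Vectors of R^|E| are rows indexed through [enum_val : 'I_#|E| -> {set V}].
   [ecoord x i j] is the entry of x at the edge [i, j]: the sum has exactly
   one term if [i, j] is an edge, and is 0 otherwise. *)
Notation evec := 'rV[R]_#|edges T|.

Definition ecoord (x : evec) (i j : V) : R :=
  \sum_(n < #|edges T| | enum_val n == [set i; j]%SET) x 0 n.

(* w_ij exp(e^{i theta} (i om + nu)) *)
Definition side (theta : R) v (i j : V) (om nu : R) : R[i] :=
  (v j - v i) * cexp (cexp (0 +i* theta) * (nu +i* om)).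

(* om and nu are the edge variables of the map z. *)
Definition edge_variables (theta : R) v z (om nu : evec) : Prop :=
  (forall i j k, tri T i j k ->
     z j - z i = side theta v i j (ecoord om i j) (ecoord nu i j)) /\
  (forall i j k, tri T i j k ->
     angle (z i) (z k) (z j) =
       angle (v i) (v k) (v j)
       + cos theta * (ecoord om j k - ecoord om k i)
       + sin theta * (ecoord nu j k - ecoord nu k i)).

(* [nu i j] is the function nu^Delta_ij for the unique triangle Delta having
   i, j as two consecutive vertices in counterclockwise order; the two values
   of nu on an interior edge [i, j] are thus [nu i j] and [nu j i].  The
   condition says that near om0 the nu^Delta are differentiable solutions of
   the closing condition, on the branch through the values nu0 at om0, up to a
   constant in every triangle. *)
Definition dependent_nu (theta : R) v (om0 nu0 : evec)
    (nu : V -> V -> evec -> R) : Prop :=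
  [/\ forall i j k, tri T i j k ->
        \forall om \near om0, differentiable (nu i j) om,
      forall i j k, tri T i j k -> \forall om \near om0,
        side theta v i j (ecoord om i j) (nu i j om)
        + side theta v j k (ecoord om j k) (nu j k om)
        + side theta v k i (ecoord om k i) (nu k i om) = 0
    & forall i j k, tri T i j k -> exists c : R,
        [/\ nu i j om0 = ecoord nu0 i j + c,
            nu j k om0 = ecoord nu0 j k + c
          & nu k i om0 = ecoord nu0 k i + c]].

(* The coefficient of d omega_e: for every triangle Delta[i, j, k] containing
   e = [i, j] the term nu_jk - nu_ki.  Lemma [Xi_coef_interior] shows that on
   interior edges this is the four-term coefficient. *)
Definition Xi_coef (nu : V -> V -> evec -> R) (om : evec) (e : {set V}) : R :=
  \sum_(p : V * V * V | tri T p.1.1 p.1.2 p.2 && (e == [set p.1.1; p.1.2]%SET))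
    (nu p.1.2 p.2 om - nu p.2 p.1.1 om).

Definition Xi_int (nu : V -> V -> evec -> R) (om x : evec) : R :=
  \sum_(n < #|edges T| | enum_val n \in interior_edges T)
    Xi_coef nu om (enum_val n) * x 0 n.

Definition Xi_bd (nu : V -> V -> evec -> R) (om x : evec) : R :=
  \sum_(n < #|edges T| | enum_val n \notin interior_edges T)
    Xi_coef nu om (enum_val n) * x 0 n.

(* On a surface with boundary Xi_int alone is closed only along the slices on
   which the variables of the boundary edges are constant, since its
   coefficients depend on these variables as well.  On the whole of R^|E| each
   boundary edge has to contribute the term of its only triangle; this leaves
   the coefficients at the interior edges unchanged, and is void along these
   slices. *)
Definition Xi (nu : V -> V -> evec -> R) (om x : evec) : R :=
  Xi_int nu om x + Xi_bd nu om x.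

Definition local_integral (nu : V -> V -> evec -> R) (om0 : evec)
    (F : evec -> R) : Prop :=
  \forall om \near om0, is_diff om F (Xi nu om).

End Geometry.

Section Hessian.
Variables (R : realType) (n : nat).

Definition hessian (F : 'rV[R]_n -> R) (x : 'rV[R]_n) : 'M[R]_n :=
  \matrix_(k, l) 'D_(delta_mx 0 k) ('D_(delta_mx 0 l) F) x.

End Hessian.

Lemma Xi_coef_interior (R : realType) (V : finType) (T : triangulation V)
    (nu : V -> V -> 'rV[R]_#|edges T| -> R) om i j k l :
  tri T i j k -> tri T i l j ->
  Xi_coef nu om [set i; j]%SET =
    nu i l om - nu l j om + nu j k om - nu k i om.
Proof.
move=> tk tl; have tl' : tri T j i l by do 2 apply: tri_cycle.
have nij := tri_neq tk.
rewrite /Xi_coef (bigD1 (i, j, k)) /=; last by rewrite tk eqxx.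
rewrite (bigD1 (j, i, l)) /=; last first.
  by rewrite tl' finset.setUC eqxx /= !xpair_eqE eq_sym (negPf nij).
rewrite big1 ?addr0 => [|[[a b] c] /= /andP[/andP[/andP[tabc /eqP eab] n1] n2]].
  by rewrite addrC addrA.
have nab := tri_neq tabc.
have : a \in [set i; j]%SET by rewrite eab !inE eqxx.
have : b \in [set i; j]%SET by rewrite eab !inE eqxx orbT.
rewrite !inE => /orP[]/eqP eb /orP[]/eqP ea; subst a b.
- by rewrite eqxx in nab.
- by move: n2; rewrite (tri_coherent tabc tl') eqxx.
- by move: n1; rewrite (tri_coherent tabc tk) eqxx.
- by rewrite eqxx in nab.
Qed.

(* Main.v *)
Require Import Defs.
From HB Require Import structures.
From mathcomp Require Import all_boot all_order all_algebra.
From mathcomp Require Import all_classical all_reals all_analysis.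
From mathcomp Require Import complex.
From mathcomp Require Import ring lra.

Set Implicit Arguments.
Unset Strict Implicit.
Unset Printing Implicit Defensive.

Import Order.TTheory GRing.Theory Num.Theory numFieldNormedType.Exports.

Local Open Scope classical_set_scope.
Local Open Scope ring_scope.

(** The second derivative splits into contributions of single triangles, and
    each of these is a quadratic form that is nonpositive because the image
    triangle is positively oriented.

    Let s1, s2, s3 be the sides of the image of one triangle, with variables
    (o1, n1), (o2, n2), (o3, n3).  Differentiating the closing condition in a
    direction multiplies each side by e^(i theta) (dn + i do); the common factor
    e^(i theta) cancels, and with zeta = dn + i do there remains
      s1 zeta1 + s2 zeta2 + s3 zeta3 = 0.
    Since s1 + s2 + s3 = 0, the differences p = zeta2 - zeta1 and
    q = zeta3 - zeta1 satisfy s2 p = - s3 q.  The contribution of the triangle,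
      (dn2 - dn3) do1 + (dn3 - dn1) do2 + (dn1 - dn2) do3,
    is unchanged by adding one constant to the three dn or to the three do, so
    it equals Im (p conj q) = - cross s2 s3 |q|^2 / |s2|^2, where cross s2 s3 is
    twice the signed area of the triangle.  It is therefore nonpositive, and it
    vanishes only if p = q = 0, that is, if the three do agree and the three dn
    agree ([triangle_form_le0]).

    Regrouping Xi by triangles ([XiE]) turns the Hessian form in the direction u
    into the sum of these contributions ([hessian_of_integral]), which gives
    semidefiniteness ([Xi_deriv_le0]).  A vector u in the kernel makes every
    contribution vanish, so that its entries agree on the edges of each
    triangle; they then agree around each vertex, because the triangles there
    form a fan, and everywhere, because the surface is connected
    ([constant_on_triangles]).  Conversely, in the direction (1, ..., 1) every
    contribution vanishes, hence so do all differences of the dn within a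
    triangle; the entries of the Hessian applied to this vector are sums of such
    differences ([Xi_deriv_const]).

    The orientation is positive at the given point, where the triangles are
    similar to those of a discrete immersion, and hence in a neighborhood of it
    ([near_regular]). *)

Local Notation Re := complex.Re.
Local Notation Im := complex.Im.

(** * The quadratic form of one triangle *)

Definition cross (R : realType) (a b : R[i]) : R := Re a * Im b - Im a * Re b.

Section OneTriangle.
Variable R : realType.
Implicit Types a b : R[i].

Lemma Im_div a b : Im (b / a) = cross a b / (Re a ^+ 2 + Im a ^+ 2).
Proof. by case: a b => [a1 a2] [b1 b2]; rewrite /cross /=; ring. Qed.

Lemma cross_gt0 a b : 0 < Im (b / a) -> 0 < cross a b.
Proof.
rewrite Im_div => ab; rewrite ltNge; apply/negP => c0.
by move: ab; rewrite ltNge mulr_le0_ge0 // invr_ge0 addr_ge0 ?sqr_ge0.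
Qed.

Lemma cross_mulr a b (k : R[i]) :
  cross (a * k) (b * k) = (Re k ^+ 2 + Im k ^+ 2) * cross a b.
Proof. by case: a b k => [a1 a2] [b1 b2] [k1 k2]; rewrite /cross /=; ring. Qed.

Lemma cexpD a b : cexp (a + b) = cexp a * cexp b.
Proof.
case: a b => [a1 a2] [b1 b2]; rewrite /cexp /= expRD cosD sinD.
by congr (_ +i* _)%C; ring.
Qed.

Lemma cexp_norm_gt0 a : 0 < Re (cexp a) ^+ 2 + Im (cexp a) ^+ 2.
Proof.
case: a => [a1 a2] /=.
by rewrite !exprMn -mulrDr cos2Dsin2 mulr1 exprn_gt0 ?expR_gt0.
Qed.

Lemma sum3_eq0 a b (d : R[i]) : a + b + d = 0 ->
  Re a + Re b + Re d = 0 /\ Im a + Im b + Im d = 0.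
Proof. by case: a b d => [? ?] [? ?] [? ?] []. Qed.

(** The two linear equations are the real and imaginary parts of
    s1 zeta1 + s2 zeta2 + s3 zeta3 = 0 with zeta = n + i o.  In the proof
    p1 + i p2 is zeta2 - zeta1, q1 + i q2 is zeta3 - zeta1, and r1 + i r2 is
    s2 (p1 + i p2) + s3 (q1 + i q2), which vanishes. *)
Lemma triangle_form_le0 (s1 s2 s3 : R[i]) (n1 n2 n3 o1 o2 o3 : R) :
  s1 + s2 + s3 = 0 -> 0 < cross s1 s2 ->
  (Re s1 * n1 - Im s1 * o1) + (Re s2 * n2 - Im s2 * o2)
    + (Re s3 * n3 - Im s3 * o3) = 0 ->
  (Im s1 * n1 + Re s1 * o1) + (Im s2 * n2 + Re s2 * o2)
    + (Im s3 * n3 + Re s3 * o3) = 0 ->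
  let q := (n2 - n3) * o1 + (n3 - n1) * o2 + (n1 - n2) * o3 in
  q <= 0 /\ (q = 0 -> [/\ o1 = o2, o2 = o3, n1 = n2 & n2 = n3]).
Proof.
move=> s0; have -> : s1 = - s2 - s3.
  by apply/eqP; rewrite -subr_eq0; apply/eqP; rewrite -[RHS]s0; ring.
case: s2 s3 {s0} => [x2 y2] [x3 y3]; rewrite /cross /= => D0 e1 e2.
set q := _ * o1 + _ + _.
pose D := x2 * y3 - y2 * x3; pose N := x2 ^+ 2 + y2 ^+ 2.
have {}D0 : 0 < D by rewrite /D; lra.
have N0 : 0 < N.
  rewrite lt0r addr_ge0 ?sqr_ge0 // paddr_eq0 ?sqr_ge0 // !sqrf_eq0 andbT.
  apply/negP => /andP[/eqP x0 /eqP y0].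
  by move: D0; rewrite /D x0 y0 !mul0r subr0 ltxx.
pose r1 := x2 * (n2 - n1) - y2 * (o2 - o1) + (x3 * (n3 - n1) - y3 * (o3 - o1)).
pose r2 := y2 * (n2 - n1) + x2 * (o2 - o1) + (y3 * (n3 - n1) + x3 * (o3 - o1)).
have r10 : r1 = 0 by rewrite -[RHS]e1 /r1; ring.
have r20 : r2 = 0 by rewrite -[RHS]e2 /r2; ring.
pose q1 := n3 - n1; pose q2 := o3 - o1.
have Nq : N * q = - (D * (q1 ^+ 2 + q2 ^+ 2)).
  (* With a = q1 + i q2 and r = r1 + i r2, the number N q is
     Im (conj (s2 a) (r - s3 a)); for r = 0 this is the claim, and the multiples
     of r1 and r2 added here make up Im (conj (s2 a) r). *)
  rewrite -[RHS]addr0 -(mulr0 (x2 * q1 - y2 * q2)) -r20.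
  rewrite -[RHS]subr0 -(mulr0 (x2 * q2 + y2 * q1)) -r10.
  by rewrite /N /q /D /r1 /r2 /q1 /q2; ring.
split=> [|q0].
  by rewrite -(pmulr_rle0 _ N0) Nq oppr_le0 pmulr_rge0 // addr_ge0 ?sqr_ge0.
have {Nq} : q1 ^+ 2 + q2 ^+ 2 = 0.
  by move/eqP: Nq; rewrite q0 mulr0 eq_sym oppr_eq0 mulf_eq0 gt_eqF //= => /eqP.
move=> /eqP; rewrite paddr_eq0 ?sqr_ge0 // !sqrf_eq0 => /andP[/eqP q10 /eqP q20].
pose p1 := n2 - n1; pose p2 := o2 - o1.
have /eqP : p1 ^+ 2 + p2 ^+ 2 = 0.
  (* now s2 p = 0, and N |p|^2 = |s2 p|^2 *)
  apply: (mulfI (lt0r_neq0 N0)); rewrite mulr0.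
  have e1' : x2 * p1 - y2 * p2 = 0.
    by rewrite -[RHS]r10 /r1 -/p1 -/p2 -/q1 -/q2 q10 q20; ring.
  have e2' : y2 * p1 + x2 * p2 = 0.
    by rewrite -[RHS]r20 /r2 -/p1 -/p2 -/q1 -/q2 q10 q20; ring.
  transitivity ((x2 * p1 - y2 * p2) ^+ 2 + (y2 * p1 + x2 * p2) ^+ 2).
    by rewrite /N; ring.
  by rewrite e1' e2' expr0n addr0.
rewrite paddr_eq0 ?sqr_ge0 // !sqrf_eq0 => /andP[/eqP p10 /eqP p20].
by move: q10 q20 p10 p20; rewrite /q1 /q2 /p1 /p2 => *; split; lra.
Qed.

End OneTriangle.

(** * Differential calculus in a normed space *)

Section Calculus.
Variables (R : realType) (E : normedModType R).
Implicit Types (x u : E).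

(** Directional derivatives are derivatives along lines; this brings in the
    chain rule for functions of one real variable. *)
Lemma is_derive_line (f : E -> R) x u df :
  is_derive x u f df <->
  is_derive (0 : R) (1 : R) (fun h : R => f (h *: u + x)) df.
Proof.
suff e : 'D_u f x = 'D_(1 : R) (fun h : R => f (h *: u + x)) 0.
  split=> -[fd <-].
    by split; [exact: (derivable1P f x u).1 | rewrite e].
  by split; [exact: (derivable1P f x u).2 | rewrite e].
rewrite /derive; set g1 := fun h => h^-1 *: _; set g2 := fun h => h^-1 *: _.
suff -> : g1 = g2 by [].
apply/funext => h; rewrite /g1 /g2 /=.
by rewrite addr0 scale0r add0r [_%:A]mulr1.
Qed.

Lemma is_derive_comp_real (f : E -> R) (g : R -> R) x u df dg :
  is_derive x u f df -> is_derive (f x) (1 : R) g dg ->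
  is_derive x u (g \o f) (dg * df).
Proof.
move=> /is_derive_line fd gd; apply/is_derive_line.
have l0 : f (0 *: u + x) = f x by rewrite scale0r add0r.
have {}gd : is_derive (f (0 *: u + x)) (1 : R) g dg by rewrite l0.
exact: (is_derive1_comp gd fd).
Qed.

Lemma is_derive_near0 (f : E -> R) x u df :
  (\near x, f x = 0) -> is_derive x u f df -> df = 0.
Proof.
by move=> f0 [_ <-]; rewrite (@near_eq_derive _ _ _ f (cst 0)) ?derive_cst.
Qed.

Lemma near_eq_differentiable (f g : E -> R) x :
  (\near x, f x = g x) -> differentiable f x -> differentiable g x.
Proof.
move=> fg df.
have [dc /eqaddoP fo] := (diff_locallyP _ _).1 df.
suff gd : g \o shift x = cst (g x) + 'd f x +o_ 0 id.
  by apply/diff_locallyP; rewrite (diff_unique dc gd).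
apply/eqaddoP => e e0; move: (fo e e0); rewrite -(nbhs_singleton fg).
have fg0 : \forall h \near 0, f (h + x) = g (h + x).
  by have := fg; rewrite (near_shift 0) /= subr0.
by apply: filter_app; near=> h; rewrite !fctE /= (near fg0 h).
Unshelve. all: by end_near. Qed.

Lemma continuous_cross (f g : E -> R[i]) x :
  {for x, continuous (fun y => Re (f y))} ->
  {for x, continuous (fun y => Im (f y))} ->
  {for x, continuous (fun y => Re (g y))} ->
  {for x, continuous (fun y => Im (g y))} ->
  {for x, continuous (fun y => cross (f y) (g y))}.
Proof. by move=> f1 f2 g1 g2; apply: cvgB; apply: cvgM. Qed.

Lemma mulmx_hessian n (F : 'rV[R]_n -> R) om (u : 'rV[R]_n) l :
  differentiable ('D_(delta_mx 0 l) F) om ->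
  (u *m hessian F om) 0 l = 'D_u ('D_(delta_mx 0 l) F) om.
Proof.
move=> dF; rewrite deriveE // [in RHS](row_sum_delta u) linear_sum /= mxE.
by apply: eq_bigr => k _; rewrite mxE deriveE // linearZ.
Qed.

End Calculus.

(** * Sides of a triangle as functions of the edge variables *)

Section Side.
Variables (R : realType) (V : finType) (theta : R) (v : V -> R[i]).
Implicit Types (i j k : V).

Let c := cos theta.
Let s := sin theta.

Lemma sideE i j om nu : side theta v i j om nu =
  (v j - v i) * ((expR (c * nu - s * om) * cos (c * om + s * nu))
                +i* (expR (c * nu - s * om) * sin (c * om + s * nu)))%C.
Proof. by rewrite /side /cexp /= expR0 !mul1r. Qed.

(** The additive constant left open for the nu of a triangle is a common
    complex factor of its sides: it does not affect the orientation. *)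
Lemma side_shift i j om nu a :
  side theta v i j om (nu + a) =
    side theta v i j om nu * cexp (cexp (0 +i* theta)%C * (a +i* 0)%C).
Proof.
rewrite /side -mulrA -cexpD -mulrDr; congr (_ * cexp (_ * _)).
by apply/eqP; rewrite eq_complex /= addr0 !eqxx.
Qed.

Variable E : normedModType R.
Implicit Types (x u : E) (om nu : E -> R).

Lemma continuous_side i j om nu x :
  {for x, continuous om} -> {for x, continuous nu} ->
  {for x, continuous (fun y => Re (side theta v i j (om y) (nu y)))} /\
  {for x, continuous (fun y => Im (side theta v i j (om y) (nu y)))}.
Proof.
move=> com cnu.
pose lam y := c * nu y - s * om y; pose phi y := c * om y + s * nu y.
have clam : {for x, continuous lam}.
  by apply: cvgB; apply: cvgM => //; apply: cvg_cst.
have cphi : {for x, continuous phi}.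
  by apply: cvgD; apply: cvgM => //; apply: cvg_cst.
have ce : {for x, continuous (expR \o lam)}.
  by apply: continuous_comp => //; apply: continuous_expR.
have cc : {for x, continuous (cos \o phi)}.
  by apply: continuous_comp => //; apply: continuous_cos.
have cs : {for x, continuous (sin \o phi)}.
  by apply: continuous_comp => //; apply: continuous_sin.
case vij : (v j - v i) => [a b].
split.
- rewrite (_ : (fun y => _) = fun y => a * (expR (lam y) * cos (phi y))
    - b * (expR (lam y) * sin (phi y))); last first.
    by apply/funext => y; rewrite sideE vij.
  by apply: cvgB; apply: cvgM; do ?[exact: cvg_cst]; apply: cvgM.
- rewrite (_ : (fun y => _) = fun y => a * (expR (lam y) * sin (phi y))
    + b * (expR (lam y) * cos (phi y))); last first.
    by apply/funext => y; rewrite sideE vij.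
  by apply: cvgD; apply: cvgM; do ?[exact: cvg_cst]; apply: cvgM.
Qed.

(** The side S moves by S (dlam + i dphi), where dlam is the change of its
    logarithmic length and dphi the change of its direction. *)
Lemma is_derive_side i j om nu x u dom dnu :
  is_derive x u om dom -> is_derive x u nu dnu ->
  let S := side theta v i j (om x) (nu x) in
  let dlam := c * dnu - s * dom in let dphi := c * dom + s * dnu in
  is_derive x u (fun y => Re (side theta v i j (om y) (nu y)))
    (Re S * dlam - Im S * dphi) /\
  is_derive x u (fun y => Im (side theta v i j (om y) (nu y)))
    (Im S * dlam + Re S * dphi).
Proof.
move=> dom' dnu' S dlam dphi.
pose lam := c *: nu - s *: om; pose phi := c *: om + s *: nu.
have ilam : is_derive x u lam dlam by apply: is_derive_eq.
have iphi : is_derive x u phi dphi by apply: is_derive_eq.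
have ie := is_derive_comp_real ilam (is_derive_expR (lam x)).
have ic := is_derive_comp_real iphi (is_derive_cos (phi x)).
have isn := is_derive_comp_real iphi (is_derive_sin (phi x)).
rewrite /S; case vij : (v j - v i) => [a b].
split.
- rewrite (_ : (fun y => _) = a *: ((expR \o lam) * (cos \o phi))
    - b *: ((expR \o lam) * (sin \o phi))); last first.
    by apply/funext => y; rewrite sideE vij.
  apply: is_derive_eq.
  by rewrite sideE vij /= -/(lam x) -/(phi x) /GRing.scale /=; ring.
- rewrite (_ : (fun y => _) = a *: ((expR \o lam) * (sin \o phi))
    + b *: ((expR \o lam) * (cos \o phi))); last first.
    by apply/funext => y; rewrite sideE vij.
  apply: is_derive_eq.
  by rewrite sideE vij /= -/(lam x) -/(phi x) /GRing.scale /=; ring.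
Qed.

(** The derivative of the closing condition, divided by e^(i theta): theta
    enters only through the sides. *)
Lemma derive_closing i j k (o1 o2 o3 n1 n2 n3 : E -> R) x u
    (do1 do2 do3 dn1 dn2 dn3 : R) :
  (\near x, side theta v i j (o1 x) (n1 x) + side theta v j k (o2 x) (n2 x)
            + side theta v k i (o3 x) (n3 x) = 0) ->
  is_derive x u o1 do1 -> is_derive x u o2 do2 -> is_derive x u o3 do3 ->
  is_derive x u n1 dn1 -> is_derive x u n2 dn2 -> is_derive x u n3 dn3 ->
  let s1 := side theta v i j (o1 x) (n1 x) in
  let s2 := side theta v j k (o2 x) (n2 x) in
  let s3 := side theta v k i (o3 x) (n3 x) in
  (Re s1 * dn1 - Im s1 * do1) + (Re s2 * dn2 - Im s2 * do2)
    + (Re s3 * dn3 - Im s3 * do3) = 0 /\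
  (Im s1 * dn1 + Re s1 * do1) + (Im s2 * dn2 + Re s2 * do2)
    + (Im s3 * dn3 + Re s3 * do3) = 0.
Proof.
move=> clo o1' o2' o3' n1' n2' n3' s1 s2 s3.
have [re1 im1] := is_derive_side i j o1' n1'.
have [re2 im2] := is_derive_side j k o2' n2'.
have [re3 im3] := is_derive_side k i o3' n3'.
have re0 := is_derive_near0 _ (is_deriveD (is_deriveD re1 re2) re3).
have im0 := is_derive_near0 _ (is_deriveD (is_deriveD im1 im2) im3).
have /re0{re0} : \near x, ((fun y => Re (side theta v i j (o1 y) (n1 y)))
     + (fun y => Re (side theta v j k (o2 y) (n2 y)))
     + (fun y => Re (side theta v k i (o3 y) (n3 y)))) x = 0.
  by near do apply: proj1 (sum3_eq0 _).
have /im0{im0} : \near x, ((fun y => Im (side theta v i j (o1 y) (n1 y)))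
     + (fun y => Im (side theta v j k (o2 y) (n2 y)))
     + (fun y => Im (side theta v k i (o3 y) (n3 y)))) x = 0.
  by near do apply: proj2 (sum3_eq0 _).
rewrite -/s1 -/s2 -/s3 => im0 re0.
(* the conclusions are c re0 + s im0 and c im0 - s re0, where c^2 + s^2 = 1 *)
have cs1 : c ^+ 2 + s ^+ 2 = 1 by exact: cos2Dsin2.
split; rewrite -[LHS]mul1r -cs1.
- by rewrite -[RHS]addr0 -{1}(mulr0 c) -{1}re0 -(mulr0 s) -im0; ring.
- by rewrite -[RHS]subr0 -{1}(mulr0 c) -{1}im0 -(mulr0 s) -re0; ring.
Unshelve. all: by end_near. Qed.

End Side.

(** * Edge vectors *)

Section EdgeVectors.
Variables (R : realType) (V : finType) (T : triangulation V).
Implicit Types (i j k : V).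
Notation evec := 'rV[R]_#|edges T|.
Implicit Types (x u om : evec).

Lemma ecoordC x i j : ecoord x i j = ecoord x j i.
Proof. by rewrite /ecoord finset.setUC. Qed.

Lemma ecoord_enum x i j (n : 'I_#|edges T|) :
  enum_val n = [set i; j]%SET -> ecoord x i j = x 0 n.
Proof.
move=> nij; rewrite /ecoord (big_pred1 n) // => m.
by rewrite -nij (inj_eq enum_val_inj).
Qed.

Lemma tri_edge_index i j k : tri T i j k ->
  exists n : 'I_#|edges T|, enum_val n = [set i; j]%SET.
Proof.
move=> t; have ij : [set i; j]%SET \in edges T.
  by apply/imsetP; exists (i, j) => //; rewrite inE; apply/existsP; exists k.
by exists (enum_rank_in ij [set i; j]%SET); rewrite enum_rankK_in.
Qed.

Lemma ecoord_linear i j : linear (fun x => ecoord x i j : R).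
Proof.
move=> a x y; rewrite -[RHS]/(a * ecoord x i j + ecoord y i j).
rewrite /ecoord mulr_sumr -big_split /=.
by apply: eq_bigr => n _; rewrite !mxE.
Qed.

Lemma ecoord_sum_delta x i j :
  ecoord x i j = \sum_l ecoord (delta_mx 0 l) i j * x 0 l.
Proof.
rewrite /ecoord; under [RHS]eq_bigr => l _ do rewrite big_distrl /=.
rewrite exchange_big /=; apply: eq_bigr => n _.
rewrite (bigD1 n) //= mxE !eqxx mul1r big1 ?addr0 // => l ln.
by rewrite mxE eqxx eq_sym (negPf ln) mul0r.
Qed.

Lemma ecoord_const (a : R) i j k :
  tri T i j k -> ecoord (const_mx a : evec) i j = a.
Proof. by case/tri_edge_index=> n /ecoord_enum ->; rewrite mxE. Qed.

Lemma continuous_ecoord i j k om :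
  tri T i j k -> {for om, continuous (fun y : evec => ecoord y i j)}.
Proof.
case/tri_edge_index=> n nij.
rewrite (_ : (fun y => _) = fun y : evec => y 0 n).
  exact: differentiable_continuous (differentiable_coord _ _ _).
by apply/funext => y; rewrite (ecoord_enum _ nij).
Qed.

Lemma is_derive_ecoord i j om u :
  is_derive om u (fun y : evec => ecoord y i j) (ecoord u i j).
Proof.
apply/is_derive_line.
rewrite (_ : (fun h : R => _) = (ecoord u i j) *: id + cst (ecoord om i j)).
  by apply: is_derive_eq; rewrite addr0 [_ *: _]mulr1.
apply/funext => h; rewrite ecoord_linear !fctE /cst /=.
by rewrite -[h *: _]/(h * _) -[_ *: h]/(_ * h) mulrC.
Qed.

Definition adjacent i j := [exists l, tri T i j l || tri T i l j].

Lemma tri_adjacent i j k : tri T i j k -> adjacent i j /\ adjacent i k.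
Proof.
by move=> t; split; apply/existsP; [exists k|exists j]; rewrite t ?orbT.
Qed.

Lemma edge_step_adjacent i j : edge_step T i j -> i = j \/ adjacent i j.
Proof.
case/existsP=> a /existsP[b /existsP[c /andP[t /fintype.subsetP s]]].
have t2 := tri_cycle t; have t3 := tri_cycle t2.
have [[ab ac] [bc ba]] := (tri_adjacent t, tri_adjacent t2).
have [ca cb] := tri_adjacent t3.
have := s i; have := s j; rewrite !inE !eqxx ?orbT.
move=> /(_ isT)/orP[/orP[]|]/eqP -> /(_ isT)/orP[/orP[]|]/eqP ->;
  by [left | right].
Qed.

(** The value is carried from edge to edge around a vertex by its fan of
    triangles ([star]), and from vertex to vertex along an edge path, each edge
    of which belongs to the stars of both of its ends ([spread]). *)
Lemma constant_on_triangles x :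
  (forall i j, connect (edge_step T) i j) ->
  (forall i j k, tri T i j k -> ecoord x i j = ecoord x j k) ->
  forall n m, x 0 n = x 0 m.
Proof.
move=> conn cst.
have star i a b : adjacent i a -> adjacent i b -> ecoord x i a = ecoord x i b.
  move=> ia ib; have /connectP[p pp ->] := tri_link ia ib.
  elim: p a {ia ib} pp => //= a' p IH a /andP[st pp]; rewrite -(IH _ pp).
  case/orP: st => t; rewrite (cst _ _ _ t).
    by rewrite (cst _ _ _ (tri_cycle t)) ecoordC.
  by rewrite -(cst _ _ _ t) ecoordC -(cst _ _ _ (tri_cycle (tri_cycle t))).
have spread i a j b :
    adjacent i a -> adjacent j b -> ecoord x i a = ecoord x j b.
  move=> ia jb; have /connectP[p pp ej] := conn i j; subst j.
  elim: p i a ia pp jb => [|j p IH] i a ia /=; first by move=> _; exact: star.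
  case/andP=> /edge_step_adjacent[<-|ij] pp jb; first exact: IH jb.
  rewrite (star _ _ _ ia ij) ecoordC; apply: IH jb => //.
  by case/existsP: ij => l /orP[]t; [case: (tri_adjacent (tri_cycle t))|
    case: (tri_adjacent (tri_cycle (tri_cycle t)))].
have dir n : exists i j, adjacent i j /\ x 0 n = ecoord x i j.
  have /imsetP[[i j]] := enum_valP n; rewrite inE => /existsP[k t] e.
  by exists i, j; split; [case: (tri_adjacent t)|rewrite (ecoord_enum _ e)].
move=> n m; have [[i [a [ia ->]]] [j [b [jb ->]]]] := (dir n, dir m).
exact: spread.
Qed.

Lemma sum_tri_rot (f : V -> V -> V -> R) :
  \sum_(p : V * V * V | tri T p.1.1 p.1.2 p.2) f p.1.1 p.1.2 p.2 =
  \sum_(p : V * V * V | tri T p.1.1 p.1.2 p.2) f p.1.2 p.2 p.1.1.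
Proof.
pose rot (p : V * V * V) := (p.1.2, p.2, p.1.1).
have rotK : cancel rot (fun p => rot (rot p)) by case=> [[? ?] ?].
have rotK' : cancel (fun p => rot (rot p)) rot by case=> [[? ?] ?].
rewrite (reindex rot) /=; last by exists (fun p => rot (rot p)) => p _.
apply: eq_bigl => -[[i j] k] /=.
by apply/idP/idP => /tri_cycle t; [exact: tri_cycle|exact: t].
Qed.

(** Regrouping by triangles: a triangle appears three times in this sum, once
    for each of its edges. *)
Lemma XiE (nu : V -> V -> evec -> R) om x :
  Xi nu om x = \sum_(p : V * V * V | tri T p.1.1 p.1.2 p.2)
    (nu p.1.2 p.2 om - nu p.2 p.1.1 om) * ecoord x p.1.1 p.1.2.
Proof.
transitivity (\sum_n Xi_coef nu om (enum_val n) * x 0 n).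
  by rewrite [RHS](bigID (fun n => enum_val n \in interior_edges T)).
under eq_bigr => n _ do rewrite /Xi_coef big_distrl /=.
rewrite (exchange_big_dep (fun p : V * V * V => tri T p.1.1 p.1.2 p.2)) /=;
  last by move=> n p _ /andP[].
apply: eq_bigr => p t; rewrite /ecoord mulr_sumr.
by apply: eq_bigl => n; rewrite t.
Qed.

Lemma near_forall_tri om0 (P : V -> V -> V -> evec -> Prop) :
  (forall i j k, tri T i j k -> \forall om \near om0, P i j k om) ->
  \forall om \near om0, forall i j k, tri T i j k -> P i j k om.
Proof.
move=> h; apply: (filter_forall (F := nbhs om0)) => i.
apply: (filter_forall (F := nbhs om0)) => j.
apply: (filter_forall (F := nbhs om0)) => k.
case t: (tri T i j k); last by near=> om.
by move: (h _ _ _ t); apply: filterS => om Pom _.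
Unshelve. all: by end_near. Qed.

End EdgeVectors.

(** * The second derivative *)

Section SecondDerivative.
Variables (R : realType) (V : finType) (T : triangulation V).
Variables (v : V -> R[i]) (theta : R) (nu : V -> V -> 'rV[R]_#|edges T| -> R).
Implicit Types (i j k : V).
Notation evec := 'rV[R]_#|edges T|.
Implicit Types (x u om : evec).

Let S i j om := side theta v i j (ecoord om i j) (nu i j om).

Definition regular_at om := forall i j k, tri T i j k ->
  [/\ differentiable (nu i j) om,
      \forall y \near om, S i j y + S j k y + S k i y = 0
    & 0 < cross (S i j om) (S j k om)].

(** At om0 the sides are those of the immersed triangles up to a common factor
    in each triangle, hence positively oriented; positive orientation is an
    open condition. *)
Lemma near_regular z om0 nu0 :
  discrete_immersion T z -> edge_variables theta v z om0 nu0 ->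
  dependent_nu theta v om0 nu0 nu -> \forall om \near om0, regular_at om.
Proof.
move=> [pos _] [zS _] [dnu clo nu0E].
apply: near_forall_tri => i j k t.
have t2 := tri_cycle t.
have d1 := dnu _ _ _ t; have d2 := dnu _ _ _ t2.
have [re1 im1] := continuous_side theta v i j (continuous_ecoord t)
   (differentiable_continuous (nbhs_singleton d1)).
have [re2 im2] := continuous_side theta v j k (continuous_ecoord t2)
   (differentiable_continuous (nbhs_singleton d2)).
have ccross : {for om0, continuous (fun y => cross (S i j y) (S j k y))}.
  exact: continuous_cross.
have cross0 : 0 < cross (S i j om0) (S j k om0).
  have [c [nu1 nu2 _]] := nu0E _ _ _ t; rewrite /S nu1 nu2.
  rewrite !side_shift cross_mulr pmulr_rgt0 ?cexp_norm_gt0 //.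
  rewrite -(zS _ _ _ t) -(zS _ _ _ t2).
  have := cross_gt0 (pos _ _ _ t).
  by case: (z i) (z j) (z k) => [? ?] [? ?] [? ?]; rewrite /cross /=; lra.
have clo2 := near_join (clo _ _ _ t).
near=> om; split.
- by near: om.
- by near: om; exact: clo2.
- by near: om; apply: (cvgr_gt _ ccross).
Unshelve. all: by end_near. Qed.

Definition corner_form u om i j k : R :=
  ('D_u (nu j k) om - 'D_u (nu k i) om) * ecoord u i j.

Definition tri_form u om i j k : R :=
  corner_form u om i j k + corner_form u om j k i + corner_form u om k i j.

Lemma tri_form_le0 om u i j k : regular_at om -> tri T i j k ->
  tri_form u om i j k <= 0 /\
  (tri_form u om i j k = 0 ->
   [/\ ecoord u i j = ecoord u j k, ecoord u j k = ecoord u k i,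
       'D_u (nu i j) om = 'D_u (nu j k) om
     & 'D_u (nu j k) om = 'D_u (nu k i) om]).
Proof.
move=> reg t; have t2 := tri_cycle t; have t3 := tri_cycle t2.
have [d1 clo c1] := reg _ _ _ t.
have [[d2 _ _] [d3 _ _]] := (reg _ _ _ t2, reg _ _ _ t3).
have D (f : evec -> R) (df : differentiable f om) : is_derive om u f ('D_u f om).
  exact/derivableP/diff_derivable.
have [re im] := derive_closing clo (is_derive_ecoord i j om u)
  (is_derive_ecoord j k om u) (is_derive_ecoord k i om u)
  (D _ d1) (D _ d2) (D _ d3).
exact: triangle_form_le0 (nbhs_singleton clo) c1 re im.
Qed.

Definition Xi_deriv u om x : R :=
  \sum_(p : V * V * V | tri T p.1.1 p.1.2 p.2)
  ('D_u (nu p.1.2 p.2) om - 'D_u (nu p.2 p.1.1) om) * ecoord x p.1.1 p.1.2.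

Lemma derive_Xi om u x : regular_at om ->
  differentiable (fun y => Xi nu y x) om /\
  'D_u (fun y => Xi nu y x) om = Xi_deriv u om x.
Proof.
move=> reg.
pose f (p : V * V * V) (y : evec) :=
  (nu p.1.2 p.2 y - nu p.2 p.1.1 y) * ecoord x p.1.1 p.1.2.
have fD p : tri T p.1.1 p.1.2 p.2 -> differentiable (f p) om /\
    is_derive om u (f p)
      (('D_u (nu p.1.2 p.2) om - 'D_u (nu p.2 p.1.1) om)
       * ecoord x p.1.1 p.1.2).
  move=> t; have t2 := tri_cycle t; have t3 := tri_cycle t2.
  have [[d2 _ _] [d3 _ _]] := (reg _ _ _ t2, reg _ _ _ t3).
  have -> : f p = ecoord x p.1.1 p.1.2 *: (nu p.1.2 p.2 - nu p.2 p.1.1).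
    by apply/funext => y; rewrite /f mulrC.
  have dd : differentiable (nu p.1.2 p.2 - nu p.2 p.1.1) om.
    exact: differentiableB.
  split; first exact: differentiableZ.
  have i2 : is_derive om u _ _ := derivableP (diff_derivable d2).
  have i3 : is_derive om u _ _ := derivableP (diff_derivable d3).
  by apply: is_derive_eq; rewrite mulrC.
have [dS iS] :
    differentiable (\sum_(p : V * V * V | tri T p.1.1 p.1.2 p.2) f p) om /\
    is_derive om u (\sum_(p : V * V * V | tri T p.1.1 p.1.2 p.2) f p)
      (Xi_deriv u om x).
  rewrite /Xi_deriv; elim/big_rec2 : _ => [|p d g t [dg ig]].
    by split; [exact: differentiable_cst | exact: is_derive_cst].
  have [df jf] := fD p t.
  by split; [exact: differentiableD | exact: is_deriveD].
have -> : (fun y => Xi nu y x) =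
    \sum_(p : V * V * V | tri T p.1.1 p.1.2 p.2) f p.
  by apply/funext => y; rewrite XiE fct_sumE.
by split => //; case: iS.
Qed.

Lemma Xi_deriv_le0 om u : regular_at om ->
  Xi_deriv u om u <= 0 /\
  (Xi_deriv u om u = 0 ->
   forall i j k, tri T i j k -> ecoord u i j = ecoord u j k).
Proof.
move=> reg.
have sum3 : 3 * Xi_deriv u om u =
    \sum_(p : V * V * V | tri T p.1.1 p.1.2 p.2)
       tri_form u om p.1.1 p.1.2 p.2.
  (* the three rotations of a triangle have the same tri_form *)
  rewrite !big_split /= (sum_tri_rot T (fun i j k => corner_form u om k i j)).
  rewrite -(sum_tri_rot T (corner_form u om)) -/(Xi_deriv u om u).
  by ring.
have tle p : tri T p.1.1 p.1.2 p.2 -> tri_form u om p.1.1 p.1.2 p.2 <= 0.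
  by move=> t; have [] := tri_form_le0 u reg t.
have sum3le : 3 * Xi_deriv u om u <= 0 by rewrite sum3; apply: sumr_le0.
split=> [|d0 i j k t]; first by move: sum3le; rewrite pmulr_rle0.
have /eqP := sum3.
rewrite d0 mulr0 eq_sym -oppr_eq0 -sumrN psumr_eq0 => [/allP|p t']; last first.
  by rewrite oppr_ge0 tle.
move=> /(_ (i, j, k)); rewrite mem_index_enum /= t oppr_eq0 => /(_ isT)/eqP t0.
by have [_ /(_ t0)[]] := tri_form_le0 u reg t.
Qed.

(** If the entries of u agree on each triangle then tri_form vanishes
    identically, and its equality case makes the derivatives of the nu agree. *)
Lemma Xi_deriv_const om u x : regular_at om ->
  (forall i j k, tri T i j k -> ecoord u i j = ecoord u j k) ->
  Xi_deriv u om x = 0.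
Proof.
move=> reg cst; rewrite /Xi_deriv big1 // => -[[i j] k] /= t.
have [e1 e2] := (cst _ _ _ t, cst _ _ _ (tri_cycle t)).
have [_] := tri_form_le0 u reg t; case.
  by rewrite /tri_form /corner_form -e2 -e1; ring.
by move=> _ _ _ ->; rewrite subrr mul0r.
Qed.

Lemma hessian_of_integral F om :
  regular_at om -> (\forall y \near om, is_diff y F (Xi nu y)) ->
  [/\ forall u, differentiable ('D_u F) om,
     forall u l, (u *m hessian F om) 0 l = Xi_deriv u om (delta_mx 0 l)
   & forall u, (u *m hessian F om *m u^T) 0 0 = Xi_deriv u om u].
Proof.
move=> reg FXi.
have DF u : \near om, Xi nu om u = 'D_u F om.
  by apply: filterS FXi => y [dF eF]; rewrite deriveE // eF.
have dDF u : differentiable ('D_u F) om.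
  by apply: near_eq_differentiable (DF u) _; case: (derive_Xi 0 u reg).
have uH u l : (u *m hessian F om) 0 l = Xi_deriv u om (delta_mx 0 l).
  rewrite mulmx_hessian // -(derive_Xi u (delta_mx 0 l) reg).2.
  exact/esym/near_eq_derive.
split=> // u; rewrite mxE.
under eq_bigr => l _ do rewrite uH mxE big_distrl /=.
rewrite exchange_big /=; apply: eq_bigr => p _.
rewrite [in RHS]ecoord_sum_delta mulr_sumr.
by apply: eq_bigr => l _; rewrite mulrA.
Qed.

Lemma kermx_hessian F om :
  regular_at om -> (\forall y \near om, is_diff y F (Xi nu y)) ->
  (forall i j, connect (edge_step T) i j) ->
  (kermx (hessian F om) :=: (const_mx 1 : evec))%MS.
Proof.
move=> reg FXi conn; have [_ uH uHu] := hessian_of_integral reg FXi.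
apply/eqmxP/andP; split.
  apply/row_subP => m; set u := row m _.
  have uH0 : u *m hessian F om = 0 by apply/sub_kermxP; apply: row_sub.
  have [_] := Xi_deriv_le0 u reg; rewrite -uHu uH0 mul0mx mxE => /(_ erefl) cst.
  have ucst := constant_on_triangles conn cst.
  have -> : u = u 0 m *: (const_mx 1 : evec).
    by apply/rowP => n; rewrite [RHS]mxE [X in _ * X]mxE mulr1; exact: ucst.
  exact: scalemx_sub.
apply/sub_kermxP/rowP => l; rewrite uH [RHS]mxE.
apply: Xi_deriv_const => // i j k t.
by rewrite (ecoord_const _ t) (ecoord_const _ (tri_cycle t)).
Qed.

End SecondDerivative.

Theorem theorem5p4 (R : realType) (V : finType) (T : triangulation V)
    (v z : V -> R[i]) (theta : R)
    (om0 nu0 : 'rV[R]_#|edges T|)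
    (nu : V -> V -> 'rV[R]_#|edges T| -> R)
    (F : 'rV[R]_#|edges T| -> R) :
  simply_connected T ->
  discrete_immersion T v ->
  0 <= theta <= pi / 2 ->
  theta_conformal T theta v z ->
  edge_variables theta v z om0 nu0 ->
  dependent_nu theta v om0 nu0 nu ->
  local_integral nu om0 F ->
  \forall om \near om0,
    [/\ forall u, differentiable ('D_u F) om,
        forall u : 'rV[R]_#|edges T|, (u *m hessian F om *m u^T) 0 0 <= 0,
        \rank (kermx (hessian F om)) = 1%N
      & (kermx (hessian F om) :=: (const_mx 1 : 'rV[R]_#|edges T|))%MS].
Proof.
move=> [/card_gt0P[i _] conn _] _ _ [zimm _] zS dnu FXi.
have [j [k t]] := tri_cover T i.
have reg := near_regular zimm zS dnu.
have FXi2 := near_join FXi.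
near=> om.
have rom : regular_at v theta nu om by near: om; exact: reg.
have Fom : \forall y \near om, is_diff y F (Xi nu y) by near: om; exact: FXi2.
have ker := kermx_hessian rom Fom conn.
have [dF _ uHu] := hessian_of_integral rom Fom.
split=> // [u|]; first by rewrite uHu; case: (Xi_deriv_le0 u rom).
(* there is an edge, so the all-ones vector is nonzero *)
rewrite ker rank_rV; case: eqVneq => // /(congr1 (fun x => ecoord x i j)).
rewrite (ecoord_const _ t) => /eqP; rewrite /ecoord big1 ?oner_eq0 // => n _.
by rewrite mxE.
Unshelve. all: by end_near. Qed.
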